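(* Let $\mathcal{M}=(M,g)$ be a pseudo-Riemannian manifold. Then $\mathcal{M}$ is Jacobi--Tsankov if and only if $\mathcal{M}$ is mixed--Tsankov.
   Context: Let $\nabla$ be the Levi-Civita connection of $(M,g)$, $\mathcal{R}(x,y)=\nabla_x\nabla_y-\nabla_y\nabla_x-\nabla_{[x,y]}$ the curvature operator, and $\mathcal{J}(x):y\mapsto\mathcal{R}(y,x)x$ the Jacobi operator. $\mathcal{M}$ is Jacobi--Tsankov if $\mathcal{J}(\xi_1)\mathcal{J}(\xi_2)=\mathcal{J}(\xi_2)\mathcal{J}(\xi_1)$ for every $P\in M$ and all $\xi_1,\xi_2\in T_PM$. $\mathcal{M}$ is mixed--Tsankov if $\mathcal{J}(\xi_1)\mathcal{R}(\xi_2,\xi_3)=\mathcal{R}(\xi_2,\xi_3)\mathcal{J}(\xi_1)$ for every $P\in M$ and all $\xi_1,\xi_2,\xi_3\in T_PM$. *)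

(* Defs.v *)
From HB Require Import structures.
From mathcomp Require Import all_boot all_order all_algebra.
From mathcomp Require Import all_classical all_reals all_analysis.

Set Implicit Arguments.
Unset Strict Implicit.
Unset Printing Implicit Defensive.

Import Order.TTheory GRing.Theory Num.Theory.
Import numFieldNormedType.Exports.

Local Open Scope classical_set_scope.
Local Open Scope ring_scope.

(* C^oo on an open set U of R^n: every iterated directional derivative of f
   is (Frechet) differentiable at every point of U. *)
Definition iter_derive (R : realType) (n : nat) (W : normedModType R)
    (vs : seq 'rV[R]_n) (f : 'rV[R]_n -> W) : 'rV[R]_n -> W :=
  foldr (fun v h => fun x => 'D_v h x) f vs.

Definition euclid_smooth_on (R : realType) (n : nat) (W : normedModType R)
    (U : set 'rV[R]_n) (f : 'rV[R]_n -> W) : Prop :=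
  forall (vs : seq 'rV[R]_n) (x : 'rV[R]_n),
    U x -> differentiable (iter_derive vs f) x.

(* [fwd] and [bwd] are total functions, meaningful only on [dom] and on its
   image respectively. *)
Record chart (R : realType) (n : nat) (M : topologicalType) := Chart {
  dom : set M;
  fwd : M -> 'rV[R]_n;
  bwd : 'rV[R]_n -> M;
  chart_dom_open : open dom;
  chart_cod_open : open (fwd @` dom);
  chart_fwdK : forall x, dom x -> bwd (fwd x) = x;
  chart_fwd_cts : forall x, dom x -> {for x, continuous fwd};
  chart_bwd_cts : forall y, (fwd @` dom) y -> {for y, continuous bwd}
}.

(* Smooth manifolds of dimension n; the atlas need not be maximal. *)
Record smoothManifold (R : realType) (n : nat) := SmoothManifold {
  manifold_pt :> topologicalType;
  atlas : set (chart R n manifold_pt);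
  manifold_hausdorff : hausdorff_space manifold_pt;
  manifold_second_countable : @second_countable manifold_pt;
  atlas_cover : forall P : manifold_pt, exists2 c, atlas c & dom c P;
  atlas_compatible : forall c c', atlas c -> atlas c' ->
    euclid_smooth_on (fwd c @` (dom c `&` dom c')) (fwd c' \o bwd c)
}.

Section Tangent.
Variables (R : realType) (n : nat) (M : smoothManifold R n).

(* Smoothness of a real function on an open subset U of M. *)
Definition smooth_on (U : set M) (f : M -> R) : Prop :=
  forall c, atlas c -> euclid_smooth_on (fwd c @` (dom c `&` U)) (f \o bwd c).

Definition smooth_at (P : M) (f : M -> R) : Prop :=
  exists U : set M, [/\ open U, U P & smooth_on U f].

(* Tangent vectors act on functions that are smooth near P.  By convention
   they are extended by 0 to all other functions, so that two tangent vectors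
   are equal as soon as they agree on the functions smooth near P. *)
Definition tvec := (M -> R) -> R.

(* T_P M: the directional derivatives at P, read in the charts around P. *)
Definition tangent (P : M) : set tvec :=
  [set xi | exists c : chart R n M, exists a : 'rV[R]_n,
     [/\ atlas c, dom c P &
         forall f : M -> R, xi f =
           if `[< smooth_at P f >] then 'D_a (f \o bwd c) (fwd c P) else 0]].

Definition field := M -> tvec.

Definition app_field (X : field) (f : M -> R) : M -> R := fun Q => X Q f.

Definition scale_field (f : M -> R) (X : field) : field :=
  fun Q h => f Q * X Q h.

Definition add_field (X Y : field) : field := fun Q h => X Q h + Y Q h.

(* Smooth vector fields on an open subset U of M; the values of X outside U
   are irrelevant. *)
Definition smooth_field (U : set M) (X : field) : Prop :=
  (forall Q, U Q -> tangent Q (X Q)) /\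
  (forall (V : set M) (f : M -> R), open V -> V `<=` U ->
     smooth_on V f -> smooth_on V (app_field X f)).

(* [X, Y] f = X (Y f) - Y (X f) *)
Definition bracket (X Y : field) : field := fun P f =>
  if `[< smooth_at P f >]
  then X P (app_field Y f) - Y P (app_field X f) else 0.

(* Pseudo-Riemannian metrics, of arbitrary signature. *)
Record pseudo_riemannian (g : M -> tvec -> tvec -> R) : Prop := {
  metric_sym : forall P xi eta, tangent P xi -> tangent P eta ->
    g P xi eta = g P eta xi;
  metric_linear : forall P (a b : R) xi eta zeta,
    tangent P xi -> tangent P eta -> tangent P zeta ->
    g P (fun f => a * xi f + b * eta f) zeta =
      a * g P xi zeta + b * g P eta zeta;
  metric_nondegenerate : forall P xi, tangent P xi ->
    (forall eta, tangent P eta -> g P xi eta = 0) -> xi = (fun=> 0);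
  metric_smooth : forall (U : set M) X Y, open U ->
    smooth_field U X -> smooth_field U Y ->
    smooth_on U (fun Q => g Q (X Q) (Y Q))
}.

(* The Levi-Civita connection of g, acting on vector fields that are smooth on
   some open set; it is determined on those by these axioms, and its values on
   other arguments are irrelevant. *)
Record levi_civita (g : M -> tvec -> tvec -> R)
    (nabla : field -> field -> field) : Prop := {
  nabla_smooth : forall (U : set M) X Y, open U ->
    smooth_field U X -> smooth_field U Y -> smooth_field U (nabla X Y);
  nabla_addl : forall (U : set M) X X' Y, open U ->
    smooth_field U X -> smooth_field U X' -> smooth_field U Y ->
    forall P, U P ->
      nabla (add_field X X') Y P = add_field (nabla X Y) (nabla X' Y) P;
  nabla_scalel : forall (U : set M) f X Y, open U -> smooth_on U f ->
    smooth_field U X -> smooth_field U Y ->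
    forall P, U P -> nabla (scale_field f X) Y P = scale_field f (nabla X Y) P;
  nabla_addr : forall (U : set M) X Y Y', open U ->
    smooth_field U X -> smooth_field U Y -> smooth_field U Y' ->
    forall P, U P ->
      nabla X (add_field Y Y') P = add_field (nabla X Y) (nabla X Y') P;
  nabla_leibniz : forall (U : set M) f X Y, open U -> smooth_on U f ->
    smooth_field U X -> smooth_field U Y ->
    forall P, U P -> nabla X (scale_field f Y) P =
      add_field (scale_field (app_field X f) Y) (scale_field f (nabla X Y)) P;
  nabla_torsion_free : forall (U : set M) X Y, open U ->
    smooth_field U X -> smooth_field U Y ->
    forall P, U P ->
      nabla X Y P = add_field (nabla Y X) (bracket X Y) P;
  nabla_metric : forall (U : set M) X Y Z, open U ->
    smooth_field U X -> smooth_field U Y -> smooth_field U Z ->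
    forall P, U P -> X P (fun Q => g Q (Y Q) (Z Q)) =
      g P (nabla X Y P) (Z P) + g P (Y P) (nabla X Z P)
}.

Variable nabla : field -> field -> field.

Definition curv_field (X Y Z : field) : field := fun P f =>
  nabla X (nabla Y Z) P f - nabla Y (nabla X Z) P f
  - nabla (bracket X Y) Z P f.

(* A vector field, smooth near P, with value xi at P. *)
Definition extension (P : M) (xi : tvec) : field :=
  xget (fun=> fun=> 0)
    [set X : field | X P = xi /\
       exists U : set M, [/\ open U, U P & smooth_field U X]].

(* The curvature operator on T_P M; by tensoriality it does not depend on the
   extensions. *)
Definition curv (P : M) (xi eta zeta : tvec) : tvec :=
  curv_field (extension P xi) (extension P eta) (extension P zeta) P.

Definition jacobi (P : M) (xi eta : tvec) : tvec := curv P eta xi xi.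

Definition jacobi_tsankov : Prop :=
  forall (P : M) (xi1 xi2 : tvec), tangent P xi1 -> tangent P xi2 ->
  forall eta, tangent P eta ->
    jacobi P xi1 (jacobi P xi2 eta) = jacobi P xi2 (jacobi P xi1 eta).

Definition mixed_tsankov : Prop :=
  forall (P : M) (xi1 xi2 xi3 : tvec),
  tangent P xi1 -> tangent P xi2 -> tangent P xi3 ->
  forall eta, tangent P eta ->
    jacobi P xi1 (curv P xi2 xi3 eta) = curv P xi2 xi3 (jacobi P xi1 eta).

End Tangent.

(* Main.v *)
Require Import Defs.
From mathcomp Require Import all_boot all_order all_algebra.
From mathcomp Require Import all_classical all_reals all_analysis.
From mathcomp Require Import ring lra.

(** The equivalence is pointwise linear algebra: it holds for every algebraic
curvature tensor on a space with a nondegenerate symmetric form, in any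
signature.

Fix a self-adjoint operator T, and write J(y) u = R(u,y)y. The claim is that T
commutes with all J(y) if and only if T commutes with all R(y,z); applied to
T = J(x), which is self-adjoint by the pair symmetry of R, this is the theorem.

If T commutes with all R(y,z), then R(a,b,Tc,d) = R(a,b,c,Td), hence
R(Ta,b) = R(a,Tb) by pair symmetry. In particular R(Ty,y) = R(y,Ty), and the
left side is also - R(y,Ty), so R(y,Ty) = 0. The Bianchi identity for v, Ty, y
then reads R(v,Ty)y = R(v,y)Ty; the left side is J(y)Tv, the right side is
T J(y) v ([commute_curv_jacobi]).

If T commutes with all J(y), polarize in y and consider
S(u,v;y,z) = R(u,y,z,v) + R(u,z,y,v). This tensor is symmetric in each pair and
under exchange of the pairs, its cyclic sums vanish, and T can be moved between
u and v. Inserting T in each of the four slots of the cyclic identity gives four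
linear equations, which force T to move freely between the two pairs as well.
Since 3 R(u,y,z,v) = S(u,v;y,z) - S(u,z;y,v), the same holds for R
([commute_jacobi_curv]).

The rest shows that the curvature operator on a tangent space is such a tensor
([curvature_model_at]). It is defined by choosing extensions of tangent vectors
to vector fields, so the crux is tensoriality: the curvature of three fields at
P depends only on their values at P ([curvE]). The curvature of fields is
additive and linear over smooth functions in each slot, and a field is near P a
combination of coordinate fields whose coefficients at P are determined by its
value at P ([tensorial]). This rests on the chain rule and the stability of
smoothness under composition, which make smoothness and tangency independent of
the chart. The symmetries of the curvature are the usual consequences of the
Jacobi identity, the vanishing of torsion and the compatibility with g. That
the bracket of two fields is again a smooth field, usually a consequence of the
symmetry of second partial derivatives, is read off from the vanishing of
torsion: the bracket is a difference of covariant derivatives ([bracket_at]). *)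

Set Implicit Arguments.
Unset Strict Implicit.
Unset Printing Implicit Defensive.

Import Order.TTheory GRing.Theory Num.Theory.
Import numFieldNormedType.Exports.

Local Open Scope classical_set_scope.
Local Open Scope ring_scope.

(** * Algebraic curvature tensors *)

(** An algebraic curvature tensor K with a symmetric form g, presented as a
operator-valued map. The underlying vector space is a subset D of an additive
group, as tangent spaces are subsets of the space of all functionals. Maps are
additive rather than linear, because the argument polarizes but never scales. *)
Record curvature_model (R : realFieldType) (V : zmodType) (D : set V)
    (g : V -> V -> R) (K : V -> V -> V -> V) : Prop := {
  modelD : forall x y, D x -> D y -> D (x + y);
  modelN : forall x, D x -> D (- x);
  model_gC : forall x y, D x -> D y -> g x y = g y x;
  model_gD : forall x y z, D x -> D y -> D z -> g (x + y) z = g x z + g y z;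
  model_nondegenerate : forall x, D x -> (forall y, D y -> g x y = 0) -> x = 0;
  model_K : forall x y z, D x -> D y -> D z -> D (K x y z);
  model_KDl : forall x x' y z, D x -> D x' -> D y -> D z ->
    K (x + x') y z = K x y z + K x' y z;
  model_KDr : forall x y z z', D x -> D y -> D z -> D z' ->
    K x y (z + z') = K x y z + K x y z';
  model_Kskew : forall x y z, D x -> D y -> D z -> K x y z = - K y x z;
  model_bianchi : forall x y z, D x -> D y -> D z ->
    K x y z + K y z x + K z x y = 0;
  model_gK : forall x y z w, D x -> D y -> D z -> D w ->
    g (K x y z) w = - g z (K x y w)
}.

Section Model.
Variables (R : realFieldType) (V : zmodType) (D : set V).
Variables (g : V -> V -> R) (K : V -> V -> V -> V).
Hypothesis m : curvature_model D g K.

Let r x y z w := g (K x y z) w.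

Let gN x y : D x -> D y -> g (- x) y = - g x y.
Proof.
move=> Dx Dy; have DNx := modelN m Dx.
have g0 : g 0 y = 0.
  have D0 : D 0 by rewrite -(subrr x); exact: modelD m _ _ _ _.
  have := model_gD m D0 D0 Dy; rewrite addr0 => /eqP.
  by rewrite -subr_eq0 opprD addNKr oppr_eq0 => /eqP.
by have := model_gD m Dx DNx Dy; rewrite subrr g0; lra.
Qed.

Let r_skew x y z w : D x -> D y -> D z -> D w -> r x y z w = - r y x z w.
Proof.
move=> Dx Dy Dz Dw; rewrite /r (model_Kskew m) // gN //.
exact: model_K m _ _ _ _ _ _.
Qed.

Let r_adj x y z w : D x -> D y -> D z -> D w -> r x y z w = - r x y w z.
Proof.
move=> Dx Dy Dz Dw; rewrite /r (model_gK m) // (model_gC m) //.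
exact: model_K m _ _ _ _ _ _.
Qed.

Let r_bianchi x y z w : D x -> D y -> D z -> D w ->
  r x y z w + r y z x w + r z x y w = 0.
Proof.
move=> Dx Dy Dz Dw; have DK := model_K m.
rewrite /r -!(model_gD m) //; do ?by [exact: DK | apply: modelD m _ _ _ _; exact: DK].
rewrite (model_bianchi m) // -(subrr w) (model_gD m) ?gN ?subrr //.
exact: modelN m _ _.
Qed.

(** The octahedron argument: four Bianchi identities, one for each choice of the
last argument, combine to the claim. *)
Let r_pair x y z w : D x -> D y -> D z -> D w -> r x y z w = r z w x y.
Proof.
move=> Dx Dy Dz Dw.
have b1 := r_bianchi Dx Dy Dz Dw; have b2 := r_bianchi Dy Dz Dw Dx.
have b3 := r_bianchi Dz Dw Dx Dy; have b4 := r_bianchi Dw Dx Dy Dz.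
have a1 := r_adj Dy Dz Dw Dx; have a2 := r_adj Dz Dw Dy Dx.
have a3 := r_adj Dw Dy Dz Dx; have a4 := r_adj Dw Dx Dz Dy.
have a5 := r_adj Dx Dz Dw Dy; have a6 := r_adj Dx Dy Dw Dz.
have s1 := r_skew Dy Dw Dx Dz; have s2 := r_skew Dx Dz Dy Dw.
lra.
Qed.

Let rDl x x' y z w : D x -> D x' -> D y -> D z -> D w ->
  r (x + x') y z w = r x y z w + r x' y z w.
Proof.
move=> Dx Dx' Dy Dz Dw; rewrite /r (model_KDl m) // (model_gD m) //.
all: exact: model_K m _ _ _ _ _ _.
Qed.

Let rDr x y z z' w : D x -> D y -> D z -> D z' -> D w ->
  r x y (z + z') w = r x y z w + r x y z' w.
Proof.
move=> Dx Dy Dz Dz' Dw; rewrite /r (model_KDr m) // (model_gD m) //.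
all: exact: model_K m _ _ _ _ _ _.
Qed.

(** The polarized Jacobi operator in symmetric form: s u v y z is
g (J(y,z) u) v up to a factor 2. Its symmetries make it easier to handle than
r, and it determines r by [r_of_s]. *)
Let s u v y z := r u y z v + r u z y v.

Let s_C u v y z : D u -> D v -> D y -> D z -> s u v y z = s v u y z.
Proof.
move=> Du Dv Dy Dz; rewrite /s (r_pair Du Dy) // (r_pair Du Dz) //.
rewrite (r_skew Dz Dv) // (r_adj Dv Dz) // (r_skew Dy Dv) // (r_adj Dv Dy) //.
by lra.
Qed.

Let s_pair u v y z : D u -> D v -> D y -> D z -> s u v y z = s y z u v.
Proof.
move=> Du Dv Dy Dz; rewrite /s (r_skew Du Dy) // (r_adj Dy Du) //.
by rewrite (r_pair Du Dz) //; lra.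
Qed.

Let s_cycle u v y z : D u -> D v -> D y -> D z ->
  s u v y z + s u y v z + s u z v y = 0.
Proof.
move=> Du Dv Dy Dz; rewrite /s (r_adj Du Dy Dz) // (r_adj Du Dz Dy) //.
by rewrite (r_adj Du Dv Dz) //; lra.
Qed.

Let r_of_s u y z v : D u -> D y -> D z -> D v ->
  3 * r u y z v = s u v y z - s u z y v.
Proof.
move=> Du Dy Dz Dv; have b := r_bianchi Dy Dz Dv Du.
have p1 := r_pair Du Dy Dz Dv; have p2 := r_pair Du Dz Dv Dy.
have p3 := r_pair Du Dv Dy Dz.
have a1 := r_adj Dz Dv Dy Du; have a2 := r_adj Dv Dy Dz Du.
have a3 := r_adj Dy Dz Dv Du; have a4 := r_adj Du Dy Dv Dz.
have a5 := r_adj Du Dz Dv Dy.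
by rewrite /s; lra.
Qed.

Section Commutation.
Variable T : V -> V.
Hypothesis DT : forall x, D x -> D (T x).
Hypothesis T_adj : forall x y, D x -> D y -> g (T x) y = g x (T y).

Let eq_of_g x y : D x -> D y -> (forall z, D z -> g x z = g y z) -> x = y.
Proof.
move=> Dx Dy e; apply/eqP; rewrite -subr_eq0; apply/eqP.
apply: (model_nondegenerate m); first by apply: modelD m _ _ _ _ => //; exact: modelN m _ _.
move=> z Dz; rewrite (model_gD m) // ?gN ?e ?subrr //; exact: modelN m _ _.
Qed.

(** The hypothesis only lets T pass inside the pair (u,v) of s; the cyclic
identities carry it over to the pair (y,z). *)
Lemma commute_jacobi_curv :
  (forall y u, D y -> D u -> T (K u y y) = K (T u) y y) ->
  forall y z u, D y -> D z -> D u -> T (K y z u) = K y z (T u).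
Proof.
move=> TJ.
have TJr u v y : D u -> D v -> D y -> r (T u) y y v = r u y y (T v).
  move=> Du Dv Dy; rewrite /r -TJ // T_adj //; exact: model_K m _ _ _ _ _ _.
have Ts u v y z : D u -> D v -> D y -> D z -> s (T u) v y z = s u (T v) y z.
  move=> Du Dv Dy Dz; have DTu := DT Du; have DTv := DT Dv.
  have Dyz := modelD m Dy Dz.
  have rDm a b w : D a -> D b -> D w ->
      r a (y + z) w b = r a y w b + r a z w b.
    move=> Da Db Dw; rewrite (r_skew Da) // rDl //.
    by rewrite (r_skew Dy) // (r_skew Dz) //; lra.
  (* polarization of TJr at y + z; the diagonal terms cancel by TJr *)
  have := TJr _ _ _ Du Dv Dyz.
  rewrite !rDm // !rDr // !TJr //.
  by rewrite /s; lra.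
have Tswap u v y z : D u -> D v -> D y -> D z -> s (T u) v y z = s u v (T y) z.
  move=> Du Dv Dy Dz; have DTu := DT Du; have DTv := DT Dv.
  have DTy := DT Dy; have DTz := DT Dz.
  have c1 := s_cycle DTu Dv Dy Dz.
  have c2 := s_cycle DTv Du Dy Dz.
  have c3 := s_cycle DTy Du Dv Dz.
  have c4 := s_cycle DTz Du Dv Dy.
  have e1 : s (T v) u y z = s (T u) v y z by rewrite Ts // s_C.
  have e2 : s (T y) u v z = s (T u) y v z by rewrite Ts // s_C.
  have e3 : s (T z) u v y = s (T u) z v y by rewrite Ts // s_C.
  have e4 : s (T y) v u z = s (T v) y u z by rewrite Ts // s_C.
  have e5 : s (T z) v u y = s (T v) z u y by rewrite Ts // s_C.
  have e6 : s (T z) y u v = s (T y) z u v by rewrite Ts // s_C.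
  (* Up to symmetry T can be placed in s in six ways, two for each splitting of
     the four vectors into pairs; c1 to c4 force the two to agree. *)
  by rewrite (s_pair Du Dv) //; lra.
have Tmove a b c d : D a -> D b -> D c -> D d -> s a b c (T d) = s a (T b) c d.
  move=> Da Db Dc Dd; have DTc := DT Dc; have DTd := DT Dd.
  by rewrite -Ts // Tswap // [RHS]s_pair // Ts // s_pair.
move=> y z u Dy Dz Du; have DTu := DT Du; have DK := model_K m.
apply: eq_of_g => [||v Dv]; [exact/DT/DK|exact: DK|].
have DTv := DT Dv.
rewrite T_adj //; last exact: DK.
have : 3 * r y z u (T v) = 3 * r y z (T u) v.
  by rewrite !r_of_s // !Tmove.
by rewrite /r; lra.
Qed.

(** By pair symmetry T also moves between the first two arguments of r, so
r y (T y) vanishes by skewness, and the Bianchi identity exchanges the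
arguments y and T y of r v. *)
Lemma commute_curv_jacobi :
  (forall y z u, D y -> D z -> D u -> T (K y z u) = K y z (T u)) ->
  forall y u, D y -> D u -> T (K u y y) = K (T u) y y.
Proof.
move=> TK y v Dy Dv; have DK := model_K m; have DTy := DT Dy; have DTv := DT Dv.
have Tr a b c d : D a -> D b -> D c -> D d -> r a b (T c) d = r a b c (T d).
  by move=> Da Db Dc Dd; rewrite /r -TK // T_adj //; exact: DK.
have Tr' a b c d : D a -> D b -> D c -> D d -> r (T a) b c d = r a (T b) c d.
  move=> Da Db Dc Dd; have DTa := DT Da; have DTb := DT Db.
  by rewrite r_pair // Tr // r_pair.
apply: eq_of_g => [||w Dw]; [exact/DT/DK|exact: DK|].
have DTw := DT Dw.
rewrite T_adj //; last exact: DK.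
rewrite -/(r _ _ _ _) -/(r _ _ _ _) -Tr // Tr' //.
have := r_bianchi Dv DTy Dy Dw; have := Tr' _ _ _ _ Dy Dy Dv Dw.
by rewrite (r_skew Dy Dv) // (r_skew Dy DTy) //; lra.
Qed.

End Commutation.

Let jacobi_adj x u v : D x -> D u -> D v -> g (K u x x) v = g u (K v x x).
Proof.
move=> Dx Du Dv; rewrite [RHS](model_gC m) //; last exact: model_K m _ _ _ _ _ _.
change (r u x x v = r v x x u).
by rewrite r_pair // r_skew // r_adj // opprK.
Qed.

Lemma jacobi_tsankov_mixed_model :
  (forall x y u, D x -> D y -> D u -> K (K u y y) x x = K (K u x x) y y) <->
  (forall x y z u, D x -> D y -> D z -> D u ->
     K (K y z u) x x = K y z (K u x x)).
Proof.
have DK := model_K m.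
split=> [J x y z u Dx Dy Dz Du|mixed x y u Dx Dy Du].
- apply: (@commute_jacobi_curv (fun w => K w x x)) => //.
  + by move=> w Dw; exact: DK.
  + by move=> v w Dv Dw; exact: jacobi_adj.
  + by move=> v w Dv Dw; exact: J.
- apply: (@commute_curv_jacobi (fun w => K w x x)) => //.
  + by move=> w Dw; exact: DK.
  + by move=> v w Dv Dw; exact: jacobi_adj.
  + by move=> v z w Dv Dz Dw; exact: mixed.
Qed.

End Model.

(** * Smooth functions on open subsets of Euclidean space *)

Section NearDifferentiable.
Variables (R : realType) (V W : normedModType R).

(** The increments of f and h at x agree near x, so the expansion of f at x is
also one of h, with the same differential. *)
Lemma near_eq_differentiable (f h : V -> W) (x : V) :
  (\near x, f x = h x) -> differentiable f x -> differentiable h x.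
Proof.
move=> fh df; have [dfc dfo] := (diff_locallyP x f).1 df.
have dho : h \o shift x = cst (h x) + 'd f x +o_ 0 id.
  apply/eqaddoP => e e0; have /eqaddoP/(_ e e0) := dfo.
  have : \forall y \near (0 : V), f (y + x) = h (y + x).
    by move: fh; rewrite (near_shift 0); apply: filterS => y /=; rewrite subr0.
  apply: filterS2 => y /= fhy; rewrite -(nbhs_singleton fh).
  by rewrite !fctE /= fhy.
have dE : 'd h x = 'd f x :> (V -> W) by apply: diff_unique.
by apply/diff_locallyP; rewrite dE; split.
Qed.

End NearDifferentiable.

Section SmoothCalculus.
Variables (R : realType) (n : nat).
Local Notation E := 'rV[R]_n.
Implicit Types (U : set E).

(** The truncation of smoothness at order k. Stability of smoothness under
products and compositions needs an induction on the order, in which the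
factors are undifferentiated functions on one side and derivatives on the other. *)
Definition diff_upto (W : normedModType R) (k : nat) U (f : E -> W) : Prop :=
  forall vs : seq E, (size vs <= k)%N -> forall x, U x ->
    differentiable (iter_derive vs f) x.

Lemma smoothE (W : normedModType R) U (f : E -> W) :
  euclid_smooth_on U f <-> forall k, diff_upto k U f.
Proof.
split=> [sf k vs _ x Ux|sf vs x Ux]; first exact: sf.
by apply: (sf (size vs)).
Qed.

Lemma diff_upto0 (W : normedModType R) U (f : E -> W) :
  diff_upto 0 U f <-> forall x, U x -> differentiable f x.
Proof.
split=> [sf x Ux|sf vs]; first exact: (sf [::]).
by rewrite leqn0 size_eq0 => /eqP ->.
Qed.

Lemma iter_derive_rcons (W : normedModType R) vs v (f : E -> W) :
  iter_derive (rcons vs v) f = iter_derive vs (fun x => 'D_v f x).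
Proof. by rewrite /iter_derive foldr_rcons. Qed.

Lemma diff_uptoS (W : normedModType R) k U (f : E -> W) :
  diff_upto k.+1 U f <->
  (forall x, U x -> differentiable f x) /\
  (forall v, diff_upto k U (fun x => 'D_v f x)).
Proof.
split=> [sf|[df sf] vs].
  split=> [x Ux|v vs vsk x Ux]; first exact: (sf [::]).
  by rewrite -iter_derive_rcons; apply: sf => //; rewrite size_rcons.
case/lastP: vs => [_ //|vs v]; rewrite size_rcons ltnS => vsk.
by rewrite iter_derive_rcons; exact: sf.
Qed.

Lemma diff_upto_le (W : normedModType R) k U (f : E -> W) :
  diff_upto k.+1 U f -> diff_upto k U f.
Proof. by move=> sf vs vsk; apply: sf; exact: leqW. Qed.

Lemma eq_on_near (T : topologicalType) (A : Type) (U : set T) (f h : T -> A) x :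
  open U -> (forall y, U y -> f y = h y) -> U x -> \forall y \near x, f y = h y.
Proof. by move=> oU fh Ux; apply: filterS (open_nbhs_nbhs (conj oU Ux)). Qed.

Lemma eq_diff_upto (W : normedModType R) k U (f h : E -> W) :
  open U -> (forall x, U x -> f x = h x) -> diff_upto k U f -> diff_upto k U h.
Proof.
move=> oU; elim: k f h => [|k IH] f h fh.
  rewrite !diff_upto0 => df x Ux; apply: near_eq_differentiable (df x Ux).
  exact: eq_on_near Ux.
rewrite !diff_uptoS => -[df sf]; split=> [x Ux|v].
  by apply: near_eq_differentiable (df x Ux); exact: eq_on_near Ux.
apply: IH (sf v) => x Ux; apply: near_eq_derive; exact: eq_on_near Ux.
Qed.

Lemma diff_upto_cst (W : normedModType R) k U (a : W) : diff_upto k U (fun=> a).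
Proof.
elim: k a => [|k IH] a; first by rewrite diff_upto0 => x _; exact: differentiable_cst.
rewrite diff_uptoS; split=> [x _|v]; first exact: differentiable_cst.
by under eq_fun do rewrite derive_cst; exact: IH.
Qed.

Lemma diff_uptoD (W : normedModType R) k U (f h : E -> W) : open U ->
  diff_upto k U f -> diff_upto k U h -> diff_upto k U (fun x => f x + h x).
Proof.
move=> oU; elim: k f h => [|k IH] f h.
  by rewrite !diff_upto0 => df dh x Ux; apply: differentiableD; [exact: df|exact: dh].
rewrite !diff_uptoS => -[df sf] [dh sh]; split=> [x Ux|v].
  by apply: differentiableD; [exact: df|exact: dh].
apply: eq_diff_upto (IH _ _ (sf v) (sh v)) => // x Ux.
by rewrite -deriveD //; apply: diff_derivable; [exact: df|exact: dh].
Qed.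

Lemma diff_upto_sum (W : normedModType R) k U m (f : 'I_m -> E -> W) : open U ->
  (forall i, diff_upto k U (f i)) -> diff_upto k U (fun x => \sum_i f i x).
Proof.
move=> oU sf; elim: (index_enum _) => [|i s IH].
  by under eq_fun do rewrite big_nil; exact: diff_upto_cst.
by under eq_fun do rewrite big_cons; exact: diff_uptoD.
Qed.

Lemma diff_uptoM k U (f h : E -> R) : open U ->
  diff_upto k U f -> diff_upto k U h -> diff_upto k U (fun x => f x * h x).
Proof.
move=> oU; elim: k f h => [|k IH] f h.
  by rewrite !diff_upto0 => df dh x Ux; apply: differentiableM; [exact: df|exact: dh].
move=> sf sh; have lf := diff_upto_le sf; have lh := diff_upto_le sh.
move: sf sh; rewrite !diff_uptoS => -[df sf] [dh sh]; split=> [x Ux|v].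
  by apply: differentiableM; [exact: df|exact: dh].
apply: eq_diff_upto (diff_uptoD oU (IH _ _ lf (sh v)) (IH _ _ lh (sf v))) => // x Ux.
by rewrite -[RHS]/('D_v (f * h) x) deriveM //; apply: diff_derivable; [exact: df|exact: dh].
Qed.

Lemma differentiable_coord_comp (f : E -> E) x i :
  differentiable f x -> differentiable (fun y => f y ord0 i : R) x.
Proof.
move=> df; apply: (differentiable_comp df (g := fun N : E => N ord0 i : R)).
exact: differentiable_coord.
Qed.

Lemma diff_upto_coord k U (f : E -> E) i : open U ->
  diff_upto k U f -> diff_upto k U (fun x => f x ord0 i : R).
Proof.
move=> oU; elim: k f => [|k IH] f.
  by rewrite !diff_upto0 => df x Ux; apply: differentiable_coord_comp; exact: df.
rewrite !diff_uptoS => -[df sf]; split=> [x Ux|v].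
  by apply: differentiable_coord_comp; exact: df.
apply: eq_diff_upto (IH _ (sf v)) => // x Ux.
by rewrite derive_mx ?mxE //; apply: diff_derivable; exact: df.
Qed.

Lemma derive_dir (h : E -> R) x v : differentiable h x ->
  'D_v h x = \sum_i v ord0 i * 'D_(delta_mx ord0 i) h x.
Proof.
move=> dh; rewrite deriveE // {1}(row_sum_delta v) linear_sum.
by apply: eq_bigr => i _; rewrite linearZ deriveE.
Qed.

Lemma derive_comp (h : E -> R) (f : E -> E) x v :
  differentiable f x -> differentiable h (f x) ->
  'D_v (fun y => h (f y)) x = 'D_('D_v f x) h (f x).
Proof.
move=> df dh; rewrite deriveE; last exact: (differentiable_comp df).
by rewrite (diff_comp df dh) /= !deriveE.
Qed.

(** By the chain rule a derivative of the composite is a sum of products of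
derivatives of f with partial derivatives of h composed with f, to which the
induction hypothesis applies. *)
Lemma diff_upto_comp k U U' (h : E -> R) (f : E -> E) : open U ->
  (forall x, U x -> U' (f x)) ->
  diff_upto k U f -> diff_upto k U' h -> diff_upto k U (fun x => h (f x)).
Proof.
move=> oU fU; elim: k h => [|k IH] h.
  rewrite !diff_upto0 => df dh x Ux.
  by apply: (differentiable_comp (df x Ux)); exact/dh/fU.
move=> sf sh; have lf := diff_upto_le sf.
move: sf sh; rewrite !diff_uptoS => -[df sf] [dh sh]; split=> [x Ux|v].
  by apply: (differentiable_comp (df x Ux)); exact/dh/fU.
have sD : diff_upto k U
    (fun x => \sum_i 'D_v f x ord0 i * 'D_(delta_mx ord0 i) h (f x)).
  apply: diff_upto_sum => // i; apply: diff_uptoM => //.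
    exact: diff_upto_coord.
  exact: (IH (fun y => 'D_(delta_mx ord0 i) h y)).
apply: eq_diff_upto sD => // x Ux; rewrite derive_comp ?derive_dir //; do ?exact: df.
all: exact/dh/fU.
Qed.

End SmoothCalculus.

(** * Smooth functions on a manifold *)

Section SmoothFunctions.
Variables (R : realType) (n : nat) (M : smoothManifold R n).
Implicit Types (P Q : M) (U V : set M) (f h : M -> R) (c : chart R n M).

(** The image is the preimage of U under the inverse chart, within the open
codomain. *)
Lemma open_chart_image c U : open U -> open (fwd c @` (dom c `&` U)).
Proof.
move=> oU; rewrite openE => _ [x [cx Ux] <-].
have cod : (fwd c @` dom c) (fwd c x) by exists x.
have near_cod := open_nbhs_nbhs (conj (chart_cod_open (c := c)) cod).
have near_U : \forall y \near fwd c x, U (bwd c y).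
  apply: (chart_bwd_cts cod); apply: open_nbhs_nbhs; split=> //.
  by rewrite chart_fwdK.
apply: filterS2 near_cod near_U => _ [z cz <-]; rewrite chart_fwdK // => Uz.
by exists z.
Qed.

Lemma smooth_on_subset U V f : V `<=` U -> smooth_on U f -> smooth_on V f.
Proof.
move=> VU sf c ac vs _ [x [cx Vx] <-]; apply: (sf c ac).
by exists x => //; split=> //; exact: VU.
Qed.

Lemma eq_smooth_on U f h : open U -> (forall Q, U Q -> f Q = h Q) ->
  smooth_on U f -> smooth_on U h.
Proof.
move=> oU fh sf c ac; apply/smoothE => k.
apply: eq_diff_upto ((smoothE _ _).1 (sf c ac) k); first exact: open_chart_image.
by move=> _ [x [cx Ux] <-] /=; rewrite chart_fwdK // fh.
Qed.

Lemma smooth_on_cst U (a : R) : smooth_on U (fun=> a).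
Proof. by move=> c ac; apply/smoothE => k; exact: diff_upto_cst. Qed.

Lemma smooth_onD U f h : open U -> smooth_on U f -> smooth_on U h ->
  smooth_on U (fun Q => f Q + h Q).
Proof.
move=> oU sf sh c ac; apply/smoothE => k.
exact: (diff_uptoD (open_chart_image (c := c) oU) ((smoothE _ _).1 (sf c ac) k)
  ((smoothE _ _).1 (sh c ac) k)).
Qed.

Lemma smooth_onM U f h : open U -> smooth_on U f -> smooth_on U h ->
  smooth_on U (fun Q => f Q * h Q).
Proof.
move=> oU sf sh c ac; apply/smoothE => k.
exact: (diff_uptoM (open_chart_image (c := c) oU) ((smoothE _ _).1 (sf c ac) k)
  ((smoothE _ _).1 (sh c ac) k)).
Qed.

(** The expression of f in another chart is the composite of its expression in
c with the transition map, so one chart suffices. *)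
Lemma smooth_on_chart c V f : atlas c -> open V -> V `<=` dom c ->
  euclid_smooth_on (fwd c @` V) (f \o bwd c) -> smooth_on V f.
Proof.
move=> ac oV Vc sf c' ac'; apply/smoothE => k.
have oV' := open_chart_image (c := c') oV.
have sT : diff_upto k (fwd c' @` (dom c' `&` V)) (fwd c \o bwd c').
  move=> vs _ _ [x [c'x Vx] <-]; apply: (atlas_compatible ac' ac).
  by exists x => //; split=> //; exact: Vc.
have VV' y : (fwd c' @` (dom c' `&` V)) y -> (fwd c @` V) ((fwd c \o bwd c') y).
  by move=> [x [c'x Vx] <-]; exists x; rewrite //= chart_fwdK.
apply: eq_diff_upto (diff_upto_comp oV' VV' sT ((smoothE _ _).1 sf k)) => //.
by move=> _ [x [c'x Vx] <-] /=; rewrite !chart_fwdK //; exact: Vc.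
Qed.

(** * Germs of smooth functions *)

Lemma near_open (T : topologicalType) (x : T) (A : T -> Prop) :
  (\forall y \near x, A y) ->
  exists B : set T, [/\ open B, B x & forall y, B y -> A y].
Proof.
move=> nA; have : nbhs x [set y | A y] by [].
by rewrite nbhsE => -[B [oB Bx] BA]; exists B.
Qed.

Lemma smooth_at_cst P (a : R) : smooth_at P (fun=> a).
Proof. by exists setT; split=> //; [exact: openT|exact: smooth_on_cst]. Qed.

Lemma smooth_atD P f h : smooth_at P f -> smooth_at P h ->
  smooth_at P (fun Q => f Q + h Q).
Proof.
move=> [U [oU UP sf]] [V [oV VP sh]]; have oW := openI oU oV.
exists (U `&` V); split=> //; apply: smooth_onD => //.
- exact: smooth_on_subset sf.
- exact: smooth_on_subset sh.
Qed.

Lemma smooth_atM P f h : smooth_at P f -> smooth_at P h ->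
  smooth_at P (fun Q => f Q * h Q).
Proof.
move=> [U [oU UP sf]] [V [oV VP sh]]; have oW := openI oU oV.
exists (U `&` V); split=> //; apply: smooth_onM => //.
- exact: smooth_on_subset sf.
- exact: smooth_on_subset sh.
Qed.

Lemma eq_smooth_at P f h : (\forall Q \near P, f Q = h Q) ->
  smooth_at P f -> smooth_at P h.
Proof.
move=> /near_open[V [oV VP fh]] [U [oU UP sf]]; have oW := openI oU oV.
exists (U `&` V); split=> //; apply: (@eq_smooth_on _ f) => //.
- by move=> Q [_ VQ]; exact: fh.
- exact: smooth_on_subset sf.
Qed.

Lemma near_smooth_at P f : smooth_at P f -> \forall Q \near P, smooth_at Q f.
Proof.
move=> [U [oU UP sf]]; apply: filterS (open_nbhs_nbhs (conj oU UP)) => Q UQ.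
by exists U.
Qed.

Lemma smooth_at_differentiable c P f : atlas c -> dom c P -> smooth_at P f ->
  differentiable (f \o bwd c) (fwd c P).
Proof. by move=> ac cP [U [oU UP sf]]; apply: (sf c ac [::]); exists P. Qed.

Lemma near_chart c P (A : set M) : dom c P -> nbhs P A ->
  \forall y \near fwd c P, A (bwd c y).
Proof.
move=> cP nA; have cod : (fwd c @` dom c) (fwd c P) by exists P.
by apply: (chart_bwd_cts cod); rewrite chart_fwdK.
Qed.

Definition coord c (i : 'I_n) : M -> R := fun Q => fwd c Q ord0 i.

Lemma coord_bwd c i P : dom c P ->
  \forall y \near fwd c P, (coord c i \o bwd c) y = y ord0 i.
Proof.
move=> cP; have cod : (fwd c @` dom c) (fwd c P) by exists P.
apply: filterS (open_nbhs_nbhs (conj (chart_cod_open (c := c)) cod)).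
by move=> _ [x cx <-]; rewrite /= chart_fwdK.
Qed.

Lemma smooth_at_coord c i P : atlas c -> dom c P -> smooth_at P (coord c i).
Proof.
move=> ac cP; exists (dom c); split=> //; first exact: chart_dom_open.
move=> c' ac'; have := atlas_compatible ac' ac; set U := fwd c' @` _ => sT.
apply/smoothE => k; apply: (diff_upto_coord (f := fwd c \o bwd c')).
  exact/open_chart_image/chart_dom_open.
exact: (smoothE _ _).1 sT k.
Qed.

(** * Tangent vectors *)

(** The value 0 on functions that are not smooth at P is the convention of
[tangent], which makes these functionals elements of the tangent space. *)
Definition chart_vec c P (a : 'rV[R]_n) : tvec M :=
  fun f => if `[< smooth_at P f >] then 'D_a (f \o bwd c) (fwd c P) else 0.

Lemma tangent_chart_vec c P a : atlas c -> dom c P -> tangent P (chart_vec c P a).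
Proof. by move=> ac cP; exists c, a. Qed.

(** A tangent vector given in another chart is transported to c by the
derivative of the transition map. Together with the linearity of the derivative
in the direction, this makes the tangent space a vector space. *)
Lemma tangentP c P (xi : tvec M) : atlas c -> dom c P -> tangent P xi ->
  exists a, xi = chart_vec c P a.
Proof.
move=> ac cP [c' [a [ac' c'P xiE]]].
exists ('D_a (fwd c \o bwd c') (fwd c' P)); apply/funext => f; rewrite xiE /chart_vec.
case: asboolP => // sf.
have TP : (fwd c \o bwd c') (fwd c' P) = fwd c P by rewrite /= chart_fwdK.
have dT : differentiable (fwd c \o bwd c') (fwd c' P).
  by apply: (atlas_compatible ac' ac [::]); exists P.
rewrite -[in RHS]TP.
rewrite -(derive_comp (h := f \o bwd c)) //; last first.
  by rewrite TP; exact: smooth_at_differentiable.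
apply: near_eq_derive.
have nc : nbhs P (dom c) by apply: open_nbhs_nbhs; split=> //; exact: chart_dom_open.
by apply: filterS (near_chart c'P nc) => y cy /=; rewrite chart_fwdK.
Qed.

Section TangentVector.
Variables (P : M) (xi : tvec M).
Hypothesis Txi : tangent P xi.

Lemma tangent_nonsmooth f : ~ smooth_at P f -> xi f = 0.
Proof. by case: Txi => c [a [_ _ ->]]; case: asboolP. Qed.

Lemma tangentD_fun f h : smooth_at P f -> smooth_at P h ->
  xi (fun Q => f Q + h Q) = xi f + xi h.
Proof.
case: Txi => c [a [ac cP xiE]] sf sh; have sfh := smooth_atD sf sh.
rewrite !xiE !asboolT //.
by rewrite -deriveD //; apply: diff_derivable; exact: smooth_at_differentiable.
Qed.

Lemma tangentM_fun f h : smooth_at P f -> smooth_at P h ->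
  xi (fun Q => f Q * h Q) = f P * xi h + h P * xi f.
Proof.
case: Txi => c [a [ac cP xiE]] sf sh; have sfh := smooth_atM sf sh.
rewrite !xiE !asboolT //.
rewrite -[LHS]/('D_a ((f \o bwd c) * (h \o bwd c)) (fwd c P)) deriveM;
  do ?by apply: diff_derivable; exact: smooth_at_differentiable.
by rewrite /= chart_fwdK.
Qed.

Lemma tangent_local f h : (\forall Q \near P, f Q = h Q) -> xi f = xi h.
Proof.
move=> fh; have hf : \forall Q \near P, h Q = f Q by apply: filterS fh.
case: Txi => c [a [ac cP xiE]]; rewrite !xiE.
have -> : `[< smooth_at P f >] = `[< smooth_at P h >].
  by apply/asbool_equiv_eq; split; exact: eq_smooth_at.
by case: ifP => // _; exact/near_eq_derive/(near_chart cP fh).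
Qed.

Lemma tangent_cst (a : R) : xi (fun=> a) = 0.
Proof.
case: Txi => c [v [_ _ ->]]; case: asboolP => // _.
exact: (derive_cst (a : R^o)).
Qed.

Lemma tangentZ_fun a f : smooth_at P f -> xi (fun Q => a * f Q) = a * xi f.
Proof.
move=> sf; rewrite tangentM_fun ?tangent_cst ?mulr0 ?addr0 //.
exact: smooth_at_cst.
Qed.

Lemma tangentB_fun f h : smooth_at P f -> smooth_at P h ->
  xi (fun Q => f Q - h Q) = xi f - xi h.
Proof.
move=> sf sh; have sNh := smooth_atM (smooth_at_cst P (-1)) sh.
rewrite -[xi h]mul1r -mulNr -tangentZ_fun // -tangentD_fun //.
by congr xi; apply/funext => Q; rewrite mulN1r.
Qed.

(** The components of a tangent vector in a chart are its values on the
coordinate functions. *)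
Lemma tangent_frame c : atlas c -> dom c P ->
  xi = fun f => \sum_i xi (coord c i) * chart_vec c P (delta_mx ord0 i) f.
Proof.
move=> ac cP; have [a xiE] := tangentP ac cP Txi; apply/funext => f.
have xic i : xi (coord c i) = a ord0 i.
  rewrite xiE /chart_vec asboolT; last exact: smooth_at_coord.
  rewrite (near_eq_derive _ (coord_bwd i cP)).
  have dI : derivable (@id 'rV[R]_n) (fwd c P) a by exact: derivable_id.
  have := derive_mx dI.
  rewrite derive_id => /matrixP/(_ ord0 i); rewrite mxE => ->.
  by [].
under eq_bigr do rewrite xic; rewrite xiE /chart_vec.
case: asboolP => sf; first by rewrite derive_dir //; exact: smooth_at_differentiable.
by rewrite big1 // => i _; rewrite mulr0.
Qed.

End TangentVector.

Lemma tangent_lin P (xi eta : tvec M) (a b : R) : tangent P xi -> tangent P eta ->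
  tangent P (fun f => a * xi f + b * eta f).
Proof.
move=> Txi Teta; have [c ac cP] := atlas_cover P.
have [u ->] := tangentP ac cP Txi; have [v ->] := tangentP ac cP Teta.
exists c, (a *: u + b *: v); split=> // f; rewrite /chart_vec.
case: asboolP => sf; last by rewrite !mulr0 addr0.
by rewrite !deriveE ?linearD ?linearZ //; exact: smooth_at_differentiable.
Qed.

Lemma tangentD P (xi eta : tvec M) : tangent P xi -> tangent P eta ->
  tangent P (fun f => xi f + eta f).
Proof.
move=> Txi Teta; have := tangent_lin 1 1 Txi Teta.
by under eq_fun do rewrite !mul1r.
Qed.

Lemma tangentZ P (xi : tvec M) (a : R) : tangent P xi ->
  tangent P (fun f => a * xi f).
Proof.
move=> Txi; have := tangent_lin a 0 Txi Txi.
by under eq_fun do rewrite mul0r addr0.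
Qed.

End SmoothFunctions.

(** * Smooth vector fields *)

Section Fields.
Variables (R : realType) (n : nat) (M : smoothManifold R n).
Implicit Types (P Q : M) (U V : set M) (f h : M -> R) (c : chart R n M).
Implicit Types (X Y Z : field M).

(** The germ-level counterpart of [smooth_field]. Identities between fields can
then be stated at a single point and still be used on a neighbourhood, by
[near_field_at]. *)
Definition smooth_field_at P X : Prop :=
  exists U : set M, [/\ open U, U P & smooth_field U X].

Lemma smooth_field_subset U V X : V `<=` U -> smooth_field U X -> smooth_field V X.
Proof.
move=> VU [TX sX]; split=> [Q /VU /TX //|W f oW WV]; apply: sX => //.
exact: subset_trans VU.
Qed.

Lemma eq_smooth_field U X Y : (forall Q, U Q -> X Q = Y Q) ->
  smooth_field U X -> smooth_field U Y.
Proof.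
move=> XY [TX sX]; split=> [Q UQ|V f oV VU sf]; first by rewrite -XY //; exact: TX.
apply: (@eq_smooth_on _ _ _ _ (app_field X f)) => //; last exact: sX.
by move=> Q /VU UQ; rewrite /app_field XY.
Qed.

Lemma smooth_fieldD U X Y : smooth_field U X -> smooth_field U Y ->
  smooth_field U (add_field X Y).
Proof.
move=> [TX sX] [TY sY]; split=> [Q UQ|V f oV VU sf].
  exact: tangentD (TX _ UQ) (TY _ UQ).
by apply: smooth_onD => //; [exact: sX|exact: sY].
Qed.

Lemma smooth_fieldZ U f X : smooth_on U f -> smooth_field U X ->
  smooth_field U (scale_field f X).
Proof.
move=> sf [TX sX]; split=> [Q UQ|V h oV VU sh]; first exact: tangentZ (TX _ UQ).
by apply: smooth_onM => //; [exact: smooth_on_subset sf|exact: sX].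
Qed.

(** The axioms of a connection speak of one open set for all their arguments. *)
Lemma germ_common P X Y Z f :
  smooth_field_at P X -> smooth_field_at P Y -> smooth_field_at P Z -> smooth_at P f ->
  exists U : set M, [/\ open U /\ U P, smooth_field U X, smooth_field U Y,
    smooth_field U Z & smooth_on U f].
Proof.
move=> [UX [oX PX sX]] [UY [oY PY sY]] [UZ [oZ PZ sZ]] [Uf [of_ Pf sf]].
exists ((UX `&` UY) `&` (UZ `&` Uf)); split.
- by split; [exact: openI (openI _ _) (openI _ _)|].
- by apply: smooth_field_subset sX => Q [[]].
- by apply: smooth_field_subset sY => Q [[]].
- by apply: smooth_field_subset sZ => Q [_ []].
- by apply: smooth_on_subset sf => Q [_ []].
Qed.

Lemma smooth_field_at_tangent P X : smooth_field_at P X -> tangent P (X P).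
Proof. by move=> [U [_ UP [TX _]]]; exact: TX. Qed.

Lemma near_field_at P X : smooth_field_at P X -> \forall Q \near P, smooth_field_at Q X.
Proof.
move=> [U [oU UP sX]]; apply: filterS (open_nbhs_nbhs (conj oU UP)) => Q UQ.
by exists U.
Qed.

Lemma app_smooth_at P X f : smooth_field_at P X -> smooth_at P f ->
  smooth_at P (app_field X f).
Proof.
move=> FX sf; have [U [[oU UP] [_ sX] _ _ sfU]] := germ_common FX FX FX sf.
by exists U; split=> //; exact: sX.
Qed.

Lemma smooth_field_atD P X Y : smooth_field_at P X -> smooth_field_at P Y ->
  smooth_field_at P (add_field X Y).
Proof.
move=> FX FY.
have [U [[oU UP] sX sY _ _]] := germ_common FX FY FX (smooth_at_cst P 0).
by exists U; split=> //; exact: smooth_fieldD.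
Qed.

Lemma smooth_field_atZ P f X : smooth_at P f -> smooth_field_at P X ->
  smooth_field_at P (scale_field f X).
Proof.
move=> sf FX; have [U [[oU UP] sX _ _ sfU]] := germ_common FX FX FX sf.
by exists U; split=> //; exact: smooth_fieldZ.
Qed.

Definition opp_field X : field M := scale_field (fun=> -1) X.

Lemma smooth_field_atN P X : smooth_field_at P X -> smooth_field_at P (opp_field X).
Proof. by move=> FX; apply: smooth_field_atZ => //; exact: smooth_at_cst. Qed.

Lemma eq_field_at P X Y : (\forall Q \near P, X Q = Y Q) ->
  smooth_field_at P X -> smooth_field_at P Y.
Proof.
move=> /near_open[V [oV VP XY]] [U [oU UP sX]]; exists (U `&` V).
split=> //; first exact: openI.
apply: (@eq_smooth_field _ X) => [Q [_ /XY //]|].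
by apply: smooth_field_subset sX => Q [].
Qed.

Definition chart_field c (a : 'rV[R]_n) : field M := fun Q => chart_vec c Q a.

Lemma chart_field_at c a P : atlas c -> dom c P -> smooth_field_at P (chart_field c a).
Proof.
move=> ac cP; exists (dom c); split=> //; first exact: chart_dom_open.
split=> [Q cQ|V f oV Vc sf]; first exact: tangent_chart_vec.
apply: (smooth_on_chart ac oV Vc); apply/smoothE => k.
have imV : fwd c @` V = fwd c @` (dom c `&` V).
  by congr image; apply/esym/setIidr.
have oV' : open (fwd c @` V) by rewrite imV; exact: open_chart_image.
have /(diff_uptoS _ _ _).1[_ /(_ a)] := (smoothE _ _).1 (sf c ac) k.+1.
rewrite -imV; apply: eq_diff_upto => // _ [x Vx <-].
rewrite /= /app_field /chart_field /chart_vec chart_fwdK; last exact: Vc.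
by rewrite asboolT //; exists V.
Qed.

(** The field with constant components in a chart extends xi, hence so does the
chosen extension. *)
Lemma extensionP P xi : tangent P xi ->
  extension P xi P = xi /\ smooth_field_at P (extension P xi).
Proof.
move=> Txi; have [c ac cP] := atlas_cover P; have [a xiE] := tangentP ac cP Txi.
rewrite /extension; case: xgetP => [X -> //|/(_ (chart_field c a)) []].
by split; [rewrite xiE|exact: chart_field_at].
Qed.

(** * Locality and tensoriality *)
Section Germs.
Variables (P : M) (F : field M -> tvec M).
Hypothesis FD : forall X Y, smooth_field_at P X -> smooth_field_at P Y ->
  F (add_field X Y) = fun h => F X h + F Y h.

(** The difference D of X and Y vanishes near P, so it is literally equal to
f D, where f is 0 near P and 1 elsewhere; f is smooth at P, being locally
constant there. *)
Lemma germ_local :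
  (forall f X, (\forall Q \near P, f Q = 0) -> smooth_field_at P X ->
     F (scale_field f X) = fun=> 0) ->
  forall X Y, smooth_field_at P X -> smooth_field_at P Y -> (\forall Q \near P, X Q = Y Q) ->
  F X = F Y.
Proof.
move=> F0 X Y FX FY /near_open[U [oU UP XY]].
pose f Q : R := if `[< U Q >] then 0 else 1.
pose D := add_field Y (opp_field X).
have FDf : smooth_field_at P D by apply: smooth_field_atD => //; exact: smooth_field_atN.
have f0 : \forall Q \near P, f Q = 0.
  apply: filterS (open_nbhs_nbhs (conj oU UP)) => Q UQ.
  by rewrite /f asboolT.
have DE : scale_field f D = D.
  apply/funext => Q; apply/funext => h; rewrite /scale_field /f.
  case: asboolP => UQ; rewrite ?mul1r // mul0r.
  by rewrite /D /add_field /opp_field /scale_field XY //; ring.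
have -> : Y = add_field X D.
  apply/funext => Q; apply/funext => h.
  by rewrite /D /add_field /opp_field /scale_field; ring.
rewrite FD // -DE F0 //; apply/funext => h; by rewrite addr0.
Qed.

Hypothesis FZ : forall f X, smooth_at P f -> smooth_field_at P X ->
  F (scale_field f X) = fun h => f P * F X h.

Lemma tensor_local X Y : smooth_field_at P X -> smooth_field_at P Y ->
  (\forall Q \near P, X Q = Y Q) -> F X = F Y.
Proof.
apply: germ_local => f Z f0 FZ'; apply/funext => h.
rewrite FZ // ?(nbhs_singleton f0) ?mul0r //.
by apply: eq_smooth_at (smooth_at_cst P 0); apply: filterS f0.
Qed.

(** Expand X near P in the coordinate fields: the value of F then only involves
the components of X at P. *)
Lemma tensorial X Y : smooth_field_at P X -> smooth_field_at P Y -> X P = Y P -> F X = F Y.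
Proof.
move=> FX FY XYP; have [c ac cP] := atlas_cover P.
pose E i := chart_field c (delta_mx ord0 i).
have FE i : smooth_field_at P (E i) by exact: chart_field_at.
have sc i : smooth_at P (coord c i) by exact: smooth_at_coord.
suff frame Z : smooth_field_at P Z ->
    F Z = fun h => \sum_i Z P (coord c i) * F (E i) h.
  by rewrite !frame // XYP.
move=> FZ'.
pose S s : field M := fun Q h => \sum_(i <- s) Z Q (coord c i) * E i Q h.
have FS s : smooth_field_at P (S s) /\
    F (S s) = fun h => \sum_(i <- s) Z P (coord c i) * F (E i) h.
  elim: s => [|i s [FSs IH]].
    have S0 : S [::] = scale_field (fun=> 0) Z.
      by apply/funext => Q; apply/funext => h; rewrite /S big_nil /scale_field mul0r.
    rewrite S0; split; first by apply: smooth_field_atZ => //; exact: smooth_at_cst.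
    rewrite FZ //; last exact: smooth_at_cst.
    by apply/funext => h; rewrite mul0r big_nil.
  have SS : S (i :: s) =
      add_field (scale_field (app_field Z (coord c i)) (E i)) (S s).
    by apply/funext => Q; apply/funext => h; rewrite /S big_cons.
  have sZ := app_smooth_at FZ' (sc i).
  have FZE := smooth_field_atZ sZ (FE i).
  rewrite SS; split; first exact: smooth_field_atD.
  rewrite FD // FZ // IH; apply/funext => h.
  by rewrite big_cons.
have [FSe <-] := FS (index_enum 'I_n).
apply: tensor_local => //.
have nc : nbhs P (dom c) by apply: open_nbhs_nbhs; split=> //; exact: chart_dom_open.
apply: filterS2 nc (near_field_at FZ') => Q cQ FZQ.
exact: (tangent_frame (smooth_field_at_tangent FZQ) ac cQ).
Qed.

End Germs.

(** * Lie brackets *)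
Section BracketFormulas.
Variable P : M.

Lemma bracketE X Y h : smooth_at P h ->
  bracket X Y P h = X P (app_field Y h) - Y P (app_field X h).
Proof. by move=> sh; rewrite /bracket asboolT. Qed.

Lemma bracketN X Y h : bracket Y X P h = - bracket X Y P h.
Proof. by rewrite /bracket; case: ifP => _; rewrite ?opprB ?oppr0. Qed.

Lemma bracketDl X X' Y : smooth_field_at P X -> smooth_field_at P X' -> smooth_field_at P Y ->
  bracket (add_field X X') Y P = add_field (bracket X Y) (bracket X' Y) P.
Proof.
move=> FX FX' FY; apply/funext => h; rewrite /add_field /bracket.
case: asboolP => sh; last by rewrite addr0.
rewrite /app_field (tangentD_fun (smooth_field_at_tangent FY)).
- by rewrite /app_field; ring.
- exact: (app_smooth_at FX).
- exact: (app_smooth_at FX').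
Qed.

Lemma bracketZl f X Y : smooth_at P f -> smooth_field_at P X -> smooth_field_at P Y ->
  bracket (scale_field f X) Y P =
  add_field (scale_field f (bracket X Y))
    (opp_field (scale_field (app_field Y f) X)) P.
Proof.
move=> sf FX FY; apply/funext => h.
rewrite /add_field /opp_field /scale_field /bracket.
case: asboolP => sh; last first.
  by rewrite (tangent_nonsmooth (smooth_field_at_tangent FX) sh) !mulr0 addr0.
rewrite /app_field (tangentM_fun (smooth_field_at_tangent FY) sf).
  by ring.
exact: (app_smooth_at FX).
Qed.

End BracketFormulas.

(** On functions smooth near P the bracket is the commutator at every nearby
point, and tangent vectors are local. *)
Lemma tangent_bracket P (xi : tvec M) X Y h : tangent P xi ->
  smooth_field_at P X -> smooth_field_at P Y -> smooth_at P h ->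
  xi (app_field (bracket X Y) h) =
  xi (app_field X (app_field Y h)) - xi (app_field Y (app_field X h)).
Proof.
move=> Txi FX FY sh; rewrite -(tangentB_fun Txi).
- apply: (tangent_local Txi).
  by apply: filterS (near_smooth_at sh) => Q sQ; rewrite /app_field bracketE.
- exact/app_smooth_at/app_smooth_at.
- exact/app_smooth_at/app_smooth_at.
Qed.

Lemma bracket_jacobi P X Y Z h :
  smooth_field_at P X -> smooth_field_at P Y -> smooth_field_at P Z ->
  bracket X (bracket Y Z) P h + bracket Y (bracket Z X) P h
    + bracket Z (bracket X Y) P h = 0.
Proof.
move=> FX FY FZ; case: (pselect (smooth_at P h)) => sh; last first.
  by rewrite /bracket asboolF // !addr0.
have sX := app_smooth_at FX sh; have sY := app_smooth_at FY sh.
have sZ := app_smooth_at FZ sh.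
rewrite !bracketE // (tangent_bracket (smooth_field_at_tangent FX)) //.
rewrite (tangent_bracket (smooth_field_at_tangent FY)) //.
rewrite (tangent_bracket (smooth_field_at_tangent FZ)) //.
rewrite /app_field.
ring.
Qed.

End Fields.

(** * The curvature of the Levi-Civita connection *)

Section LeviCivita.
Variables (R : realType) (n : nat) (M : smoothManifold R n).
Variables (g : M -> tvec M -> tvec M -> R) (nabla : field M -> field M -> field M).
Hypotheses (gM : pseudo_riemannian g) (LC : levi_civita g nabla).
Implicit Types (P Q : M) (U V : set M) (f h : M -> R) (c : chart R n M).
Implicit Types (X Y Z W : field M).

Let s0 P : smooth_at P (fun=> 0 : R) := smooth_at_cst P 0.

Section AtPoint.
Variable P : M.

Lemma nabla_at X Y : smooth_field_at P X -> smooth_field_at P Y -> smooth_field_at P (nabla X Y).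
Proof.
move=> FX FY; have [U [[oU UP] sX sY _ _]] := germ_common FX FY FY (s0 P).
by exists U; split=> //; exact: nabla_smooth LC _ _ _ oU sX sY.
Qed.

Lemma nablaDl X X' Y : smooth_field_at P X -> smooth_field_at P X' -> smooth_field_at P Y ->
  nabla (add_field X X') Y P = add_field (nabla X Y) (nabla X' Y) P.
Proof.
move=> FX FX' FY; have [U [[oU UP] sX sX' sY _]] := germ_common FX FX' FY (s0 P).
exact: nabla_addl LC _ _ _ _ oU sX sX' sY _ UP.
Qed.

Lemma nablaZl f X Y : smooth_at P f -> smooth_field_at P X -> smooth_field_at P Y ->
  nabla (scale_field f X) Y P = scale_field f (nabla X Y) P.
Proof.
move=> sf FX FY; have [U [[oU UP] sX sY _ sfU]] := germ_common FX FY FY sf.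
exact: nabla_scalel LC _ _ _ _ oU sfU sX sY _ UP.
Qed.

Lemma nablaDr X Y Y' : smooth_field_at P X -> smooth_field_at P Y -> smooth_field_at P Y' ->
  nabla X (add_field Y Y') P = add_field (nabla X Y) (nabla X Y') P.
Proof.
move=> FX FY FY'; have [U [[oU UP] sX sY sY' _]] := germ_common FX FY FY' (s0 P).
exact: nabla_addr LC _ _ _ _ oU sX sY sY' _ UP.
Qed.

Lemma nablaZr f X Y : smooth_at P f -> smooth_field_at P X -> smooth_field_at P Y ->
  nabla X (scale_field f Y) P =
  add_field (scale_field (app_field X f) Y) (scale_field f (nabla X Y)) P.
Proof.
move=> sf FX FY; have [U [[oU UP] sX sY _ sfU]] := germ_common FX FY FY sf.
exact: nabla_leibniz LC _ _ _ _ oU sfU sX sY _ UP.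
Qed.

Lemma nabla_torsion X Y : smooth_field_at P X -> smooth_field_at P Y ->
  nabla X Y P = add_field (nabla Y X) (bracket X Y) P.
Proof.
move=> FX FY; have [U [[oU UP] sX sY _ _]] := germ_common FX FY FY (s0 P).
exact: nabla_torsion_free LC _ _ _ oU sX sY _ UP.
Qed.

Lemma metric_smooth_at X Y : smooth_field_at P X -> smooth_field_at P Y ->
  smooth_at P (fun Q => g Q (X Q) (Y Q)).
Proof.
move=> FX FY; have [U [[oU UP] sX sY _ _]] := germ_common FX FY FY (s0 P).
by exists U; split=> //; exact: metric_smooth gM _ _ _ oU sX sY.
Qed.

Lemma nabla_metric_at X Y Z : smooth_field_at P X -> smooth_field_at P Y -> smooth_field_at P Z ->
  X P (fun Q => g Q (Y Q) (Z Q)) =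
    g P (nabla X Y P) (Z P) + g P (Y P) (nabla X Z P).
Proof.
move=> FX FY FZ; have [U [[oU UP] sX sY sZ _]] := germ_common FX FY FZ (s0 P).
exact: nabla_metric LC _ _ _ _ oU sX sY sZ _ UP.
Qed.

Lemma nabla_locall X X' Y : smooth_field_at P X -> smooth_field_at P X' -> smooth_field_at P Y ->
  (\forall Q \near P, X Q = X' Q) -> nabla X Y P = nabla X' Y P.
Proof.
move=> FX FX' FY; apply: (tensor_local (F := fun X => nabla X Y P)) => //.
- by move=> A B FA FB; exact: nablaDl.
- by move=> f A sf FA; exact: nablaZl.
Qed.

(** The connection is not tensorial in this argument, but for f vanishing near
P both terms of the Leibniz rule vanish at P. *)
Lemma nabla_localr X Y Y' : smooth_field_at P X -> smooth_field_at P Y -> smooth_field_at P Y' ->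
  (\forall Q \near P, Y Q = Y' Q) -> nabla X Y P = nabla X Y' P.
Proof.
move=> FX FY FY'; apply: (germ_local (F := fun Y => nabla X Y P)) => //.
- by move=> A B FA FB; exact: nablaDr.
- move=> f A f0 FA; have sf : smooth_at P f.
    by apply: eq_smooth_at (s0 P); apply: filterS f0.
  apply/funext => h; rewrite nablaZr // /add_field /scale_field /app_field.
  rewrite (tangent_local (smooth_field_at_tangent FX) f0).
  by rewrite (tangent_cst (smooth_field_at_tangent FX)) (nbhs_singleton f0) !mul0r addr0.
Qed.

End AtPoint.

(** A commutator of derivations is not visibly a directional derivative; the
absence of torsion exhibits it as a difference of covariant derivatives, which
are smooth fields. *)
Lemma bracket_at P X Y : smooth_field_at P X -> smooth_field_at P Y -> smooth_field_at P (bracket X Y).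
Proof.
move=> FX FY; apply: (@eq_field_at _ _ _ _ (add_field (nabla X Y) (opp_field (nabla Y X)))).
  apply: filterS2 (near_field_at FX) (near_field_at FY) => Q FXQ FYQ.
  apply/funext => h; rewrite /add_field /opp_field /scale_field nabla_torsion //.
  by rewrite /add_field; ring.
by apply: smooth_field_atD; [exact: nabla_at|apply: smooth_field_atN; exact: nabla_at].
Qed.

Local Notation C := (curv_field nabla).

Section Curvature.
Variable P : M.

Lemma curv_field_at X Y Z : smooth_field_at P X -> smooth_field_at P Y -> smooth_field_at P Z ->
  smooth_field_at P (C X Y Z).
Proof.
move=> FX FY FZ; have FXZ := nabla_at FX FZ; have FYZ := nabla_at FY FZ.
apply: (@eq_field_at _ _ _ _ (add_field (add_field (nabla X (nabla Y Z))
   (opp_field (nabla Y (nabla X Z)))) (opp_field (nabla (bracket X Y) Z)))).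
  apply: filterE => Q; apply/funext => h.
  by rewrite /add_field /opp_field /scale_field /curv_field; ring.
by do ![apply: smooth_field_atD|apply: smooth_field_atN|apply: nabla_at|apply: bracket_at].
Qed.

Lemma nabla_oppl X Y : smooth_field_at P X -> smooth_field_at P Y ->
  nabla (opp_field X) Y P = fun h => - nabla X Y P h.
Proof.
move=> FX FY; rewrite nablaZl //; last exact: smooth_at_cst.
by apply/funext => h; rewrite /scale_field mulN1r.
Qed.

Lemma curv_skew X Y Z : smooth_field_at P X -> smooth_field_at P Y -> smooth_field_at P Z ->
  C Y X Z P = fun h => - C X Y Z P h.
Proof.
move=> FX FY FZ; have FB := bracket_at FX FY; have FB' := bracket_at FY FX.
apply/funext => h; rewrite /curv_field.
rewrite (@nabla_locall _ (bracket Y X) (opp_field (bracket X Y))) //.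
- by rewrite nabla_oppl //; ring.
- exact: smooth_field_atN.
- apply: filterE => Q; apply/funext => k.
  by rewrite bracketN /opp_field /scale_field mulN1r.
Qed.

Lemma curvDl X X' Y Z :
  smooth_field_at P X -> smooth_field_at P X' -> smooth_field_at P Y -> smooth_field_at P Z ->
  C (add_field X X') Y Z P = fun h => C X Y Z P h + C X' Y Z P h.
Proof.
move=> FX FX' FY FZ.
have FYZ := nabla_at FY FZ; have FXZ := nabla_at FX FZ.
have FX'Z := nabla_at FX' FZ; have FXX' := smooth_field_atD FX FX'.
have FB := bracket_at FX FY; have FB' := bracket_at FX' FY.
apply/funext => h; rewrite /curv_field nablaDl //.
rewrite (@nabla_localr _ Y (nabla (add_field X X') Z)
  (add_field (nabla X Z) (nabla X' Z))) //; first last.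
- apply: filterS3 (near_field_at FX) (near_field_at FX') (near_field_at FZ).
  by move=> Q *; exact: nablaDl.
- exact: smooth_field_atD.
- exact: nabla_at.
rewrite (@nabla_locall _ (bracket (add_field X X') Y)
  (add_field (bracket X Y) (bracket X' Y))) //; first last.
- apply: filterS3 (near_field_at FX) (near_field_at FX') (near_field_at FY).
  by move=> Q *; exact: bracketDl.
- exact: smooth_field_atD.
- exact: bracket_at.
by rewrite nablaDl // nablaDr // /add_field; ring.
Qed.

(** The derivative of f produced by the second covariant derivative cancels
against the one in the bracket of f X with Y. *)
Lemma curvZl f X Y Z : smooth_at P f ->
  smooth_field_at P X -> smooth_field_at P Y -> smooth_field_at P Z ->
  C (scale_field f X) Y Z P = fun h => f P * C X Y Z P h.
Proof.
move=> sf FX FY FZ.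
have FYZ := nabla_at FY FZ; have FXZ := nabla_at FX FZ.
have FfX := smooth_field_atZ sf FX; have FB := bracket_at FX FY.
have FfB := smooth_field_atZ sf FB; have sYf := app_smooth_at FY sf.
have FYfX := smooth_field_atZ sYf FX.
apply/funext => h; rewrite /curv_field nablaZl //.
rewrite (@nabla_localr _ Y (nabla (scale_field f X) Z)
  (scale_field f (nabla X Z))) //; first last.
- apply: filterS3 (near_smooth_at sf) (near_field_at FX) (near_field_at FZ).
  by move=> Q *; exact: nablaZl.
- exact: smooth_field_atZ.
- exact: nabla_at.
rewrite (@nabla_locall _ (bracket (scale_field f X) Y)
  (add_field (scale_field f (bracket X Y))
    (opp_field (scale_field (app_field Y f) X)))) //; first last.
- apply: filterS3 (near_smooth_at sf) (near_field_at FX) (near_field_at FY).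
  by move=> Q *; exact: bracketZl.
- by apply: smooth_field_atD => //; exact: smooth_field_atN.
- exact: bracket_at.
rewrite nablaDl //; last exact: smooth_field_atN.
rewrite nablaZr // /add_field nabla_oppl // !nablaZl // /scale_field.
by ring.
Qed.

Lemma curvDr X Y Z Z' :
  smooth_field_at P X -> smooth_field_at P Y -> smooth_field_at P Z -> smooth_field_at P Z' ->
  C X Y (add_field Z Z') P = fun h => C X Y Z P h + C X Y Z' P h.
Proof.
move=> FX FY FZ FZ'; have FB := bracket_at FX FY.
have dd A B : smooth_field_at P A -> smooth_field_at P B ->
    nabla A (nabla B (add_field Z Z')) P =
    add_field (nabla A (nabla B Z)) (nabla A (nabla B Z')) P.
  move=> FA FB'; have FBZ := nabla_at FB' FZ; have FBZ' := nabla_at FB' FZ'.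
  rewrite (@nabla_localr _ A (nabla B (add_field Z Z'))
    (add_field (nabla B Z) (nabla B Z'))) ?nablaDr //.
  - by apply: nabla_at => //; exact: smooth_field_atD.
  - exact: smooth_field_atD.
  - apply: filterS3 (near_field_at FB') (near_field_at FZ) (near_field_at FZ').
    by move=> Q *; exact: nablaDr.
by apply/funext => h; rewrite /curv_field !dd // nablaDr // /add_field; ring.
Qed.

(** The second derivatives of f combine to the derivative of f along the bracket,
and the mixed terms are symmetric in X and Y. *)
Lemma curvZr f X Y Z : smooth_at P f ->
  smooth_field_at P X -> smooth_field_at P Y -> smooth_field_at P Z ->
  C X Y (scale_field f Z) P = fun h => f P * C X Y Z P h.
Proof.
move=> sf FX FY FZ; have FB := bracket_at FX FY.
have dd A B : smooth_field_at P A -> smooth_field_at P B ->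
    nabla A (nabla B (scale_field f Z)) P = fun h =>
    app_field A (app_field B f) P * Z P h + app_field B f P * nabla A Z P h
    + (app_field A f P * nabla B Z P h + f P * nabla A (nabla B Z) P h).
  move=> FA FB'; have FBZ := nabla_at FB' FZ.
  have sBf := app_smooth_at FB' sf.
  have FBfZ := smooth_field_atZ sBf FZ; have FfBZ := smooth_field_atZ sf FBZ.
  rewrite (@nabla_localr _ A (nabla B (scale_field f Z))
    (add_field (scale_field (app_field B f) Z) (scale_field f (nabla B Z)))) //.
  - by rewrite nablaDr // /add_field !nablaZr.
  - by apply: nabla_at => //; exact: smooth_field_atZ.
  - exact: smooth_field_atD.
  - apply: filterS3 (near_smooth_at sf) (near_field_at FB') (near_field_at FZ).
    by move=> Q *; exact: nablaZr.
apply/funext => h; rewrite /curv_field !dd // nablaZr //.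
rewrite /add_field /scale_field /app_field bracketE // /app_field.
by ring.
Qed.

(** Without torsion the second covariant derivatives combine to nested
brackets. *)
Lemma curv_bianchi X Y Z h : smooth_field_at P X -> smooth_field_at P Y -> smooth_field_at P Z ->
  C X Y Z P h + C Y Z X P h + C Z X Y P h = 0.
Proof.
move=> FX FY FZ; rewrite /curv_field.
have dd A B D : smooth_field_at P A -> smooth_field_at P B -> smooth_field_at P D ->
    nabla A (nabla B D) P h = nabla A (nabla D B) P h
      + nabla (bracket B D) A P h + bracket A (bracket B D) P h.
  move=> FA FB FD; have FBD := nabla_at FB FD; have FDB := nabla_at FD FB.
  have Fbr := bracket_at FB FD.
  rewrite (@nabla_localr _ A (nabla B D) (add_field (nabla D B) (bracket B D))) //.
  - by rewrite nablaDr // /add_field (nabla_torsion FA Fbr) /add_field addrA.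
  - exact: smooth_field_atD.
  - by apply: filterS2 (near_field_at FB) (near_field_at FD) => Q *; exact: nabla_torsion.
have := bracket_jacobi h FX FY FZ.
rewrite (dd X Y Z) // (dd Y Z X) // (dd Z X Y) // => J.
rewrite -[RHS]J; ring.
Qed.

Lemma metricD_l (xi eta zeta : tvec M) :
  tangent P xi -> tangent P eta -> tangent P zeta ->
  g P (fun f => xi f + eta f) zeta = g P xi zeta + g P eta zeta.
Proof.
move=> Txi Teta Tzeta; have := metric_linear gM 1 1 Txi Teta Tzeta.
by rewrite !mul1r => <-; congr g; apply/funext => f; rewrite !mul1r.
Qed.

Lemma metricN_l (xi zeta : tvec M) : tangent P xi -> tangent P zeta ->
  g P (fun f => - xi f) zeta = - g P xi zeta.
Proof.
move=> Txi Tzeta; have := metric_linear gM (-1) 0 Txi Txi Tzeta.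
rewrite mulN1r mul0r addr0 => <-; congr g; apply/funext => f.
by rewrite mulN1r mul0r addr0.
Qed.

Lemma curv_metric_l X Y Z W :
  smooth_field_at P X -> smooth_field_at P Y -> smooth_field_at P Z -> smooth_field_at P W ->
  g P (C X Y Z P) (W P) = g P (nabla X (nabla Y Z) P) (W P)
    - g P (nabla Y (nabla X Z) P) (W P) - g P (nabla (bracket X Y) Z P) (W P).
Proof.
move=> FX FY FZ FW; have FXZ := nabla_at FX FZ; have FYZ := nabla_at FY FZ.
have FB := bracket_at FX FY.
have T1 := smooth_field_at_tangent (nabla_at FX FYZ).
have T2 := smooth_field_at_tangent (nabla_at FY FXZ).
have T3 := smooth_field_at_tangent (nabla_at FB FZ).
have TW := smooth_field_at_tangent FW.
have TN xi : tangent P xi -> tangent P (fun f : M -> R => - xi f).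
  by move=> /(tangentZ (-1)); under eq_fun do rewrite mulN1r.
rewrite /curv_field metricD_l ?metricD_l ?metricN_l //; try exact: TN.
by apply: tangentD => //; exact: TN.
Qed.

(** Apply to the function g(Z,W) the identity defining the bracket and
differentiate by compatibility with the metric. *)
Lemma curv_metric_skew X Y Z W :
  smooth_field_at P X -> smooth_field_at P Y -> smooth_field_at P Z -> smooth_field_at P W ->
  g P (C X Y Z P) (W P) = - g P (Z P) (C X Y W P).
Proof.
move=> FX FY FZ FW; have FB := bracket_at FX FY.
have FC := curv_field_at FX FY FW.
rewrite [in RHS](Defs.metric_sym gM (smooth_field_at_tangent FZ) (smooth_field_at_tangent FC)).
rewrite !curv_metric_l //.
have := bracketE X Y (metric_smooth_at FZ FW).
have dd A B : smooth_field_at P A -> smooth_field_at P B ->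
   A P (app_field B (fun Q => g Q (Z Q) (W Q))) =
   g P (nabla A (nabla B Z) P) (W P) + g P (nabla B Z P) (nabla A W P)
   + (g P (nabla A Z P) (nabla B W P) + g P (Z P) (nabla A (nabla B W) P)).
  move=> FA FB'; have FBZ := nabla_at FB' FZ; have FBW := nabla_at FB' FW.
  rewrite -!nabla_metric_at // -(tangentD_fun (smooth_field_at_tangent FA)).
  - apply: (tangent_local (smooth_field_at_tangent FA)).
    apply: filterS3 (near_field_at FB') (near_field_at FZ) (near_field_at FW).
    by move=> Q *; exact: nabla_metric_at.
  - exact: metric_smooth_at.
  - exact: metric_smooth_at.
rewrite !dd // nabla_metric_at //.
have gC A B : smooth_field_at P A -> smooth_field_at P B -> g P (A P) (B P) = g P (B P) (A P).
  by move=> FA FB'; apply: (Defs.metric_sym gM); exact: smooth_field_at_tangent.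
have FXW := nabla_at FX FW; have FYW := nabla_at FY FW.
rewrite (gC _ _ FZ (nabla_at FX FYW)) (gC _ _ FZ (nabla_at FY FXW)).
by rewrite (gC _ _ FZ (nabla_at FB FW)); lra.
Qed.

End Curvature.

(** Tensoriality in one slot at a time; the second slot is reduced to the first
by skewness. *)
Lemma curvE P X Y Z : smooth_field_at P X -> smooth_field_at P Y -> smooth_field_at P Z ->
  curv nabla P (X P) (Y P) (Z P) = C X Y Z P.
Proof.
move=> FX FY FZ; rewrite /curv.
have [EX FEX] := extensionP (smooth_field_at_tangent FX).
have [EY FEY] := extensionP (smooth_field_at_tangent FY).
have [EZ FEZ] := extensionP (smooth_field_at_tangent FZ).
set X' := extension P (X P) in EX FEX *; set Y' := extension P (Y P) in EY FEY *.
set Z' := extension P (Z P) in EZ FEZ *.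
transitivity (C X Y' Z' P).
  apply: (tensorial (P := P) (F := fun A => C A Y' Z' P)) => //.
  - by move=> *; exact: curvDl.
  - by move=> *; exact: curvZl.
transitivity (C X Y Z' P).
  have -> : C X Y' Z' P = fun h => - C Y' X Z' P h by exact: curv_skew.
  have -> : C X Y Z' P = fun h => - C Y X Z' P h by exact: curv_skew.
  suff -> : C Y' X Z' P = C Y X Z' P by [].
  apply: (tensorial (P := P) (F := fun A => C A X Z' P)) => //.
  - by move=> *; exact: curvDl.
  - by move=> *; exact: curvZl.
apply: (tensorial (P := P) (F := fun A => C X Y A P)) => //.
- by move=> *; exact: curvDr.
- by move=> *; exact: curvZr.
Qed.

Lemma curvature_model_at P :
  curvature_model (V := (M -> R) -> R) (tangent P) (g P) (curv nabla P).
Proof.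
have ext xi : tangent P xi -> exists2 X, smooth_field_at P X & X P = xi.
  by move=> /extensionP[XP FX]; exists (extension P xi).
split.
- by move=> x y; exact: tangentD.
- by move=> x /(tangentZ (-1)); under eq_fun do rewrite mulN1r.
- by move=> x y; exact: Defs.metric_sym.
- by move=> x y z; exact: metricD_l.
- by move=> x; exact: metric_nondegenerate.
- move=> _ _ _ /ext[X FX <-] /ext[Y FY <-] /ext[Z FZ <-].
  by rewrite curvE //; exact/smooth_field_at_tangent/curv_field_at.
- move=> _ _ _ _ /ext[X FX <-] /ext[X' FX' <-] /ext[Y FY <-] /ext[Z FZ <-].
  rewrite (curvE (smooth_field_atD FX FX') FY FZ) !curvE //; exact: curvDl.
- move=> _ _ _ _ /ext[X FX <-] /ext[Y FY <-] /ext[Z FZ <-] /ext[Z' FZ' <-].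
  rewrite (curvE FX FY (smooth_field_atD FZ FZ')) !curvE //; exact: curvDr.
- move=> _ _ _ /ext[X FX <-] /ext[Y FY <-] /ext[Z FZ <-].
  by rewrite !curvE //; exact: curv_skew.
- move=> _ _ _ /ext[X FX <-] /ext[Y FY <-] /ext[Z FZ <-].
  by rewrite !curvE //; apply/funext => h; exact: curv_bianchi.
- move=> _ _ _ _ /ext[X FX <-] /ext[Y FY <-] /ext[Z FZ <-] /ext[W FW <-].
  by rewrite !curvE //; exact: curv_metric_skew.
Qed.

End LeviCivita.

Theorem theorem1p6 (R : realType) (n : nat) (M : smoothManifold R n)
    (g : M -> tvec M -> tvec M -> R)
    (nabla : field M -> field M -> field M) :
  pseudo_riemannian g -> levi_civita g nabla ->
  (jacobi_tsankov nabla <-> mixed_tsankov nabla).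
Proof.
move=> gM LC; have m P := jacobi_tsankov_mixed_model (curvature_model_at gM LC P).
split=> [J P x y z Tx Ty Tz u Tu|J P x y Tx Ty u Tu].
  by apply: (m P).1 => // *; exact: J.
by apply: (m P).2 => // *; exact: J.
Qed.
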